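(* If a finite simple graph $G$ has a NAC-coloring, then there is no subgraph $H$ of $G$ with $V_H=V_G$ such that $H$ is $\triangle$-connected.
   Context: A coloring $\delta\colon E_G\to\{\text{blue},\text{red}\}$ is a NAC-coloring if it is surjective and $G$ contains no cycle with exactly one blue edge and no cycle with exactly one red edge. For a graph $H$, let $\sim'$ be the relation on $E_H$ with $e_1\sim' e_2$ iff some triangle subgraph of $H$ contains both $e_1,e_2$, and $\sim$ its reflexive-transitive closure; $H$ is $\triangle$-connected if $e_1\sim e_2$ for all $e_1,e_2\in E_H$.
   Formalization: The subgraph H is additionally required to be connected; otherwise H with vertex set V_G and no edges (or one edge) is vacuously triangle-connected and contradicts the claim, e.g. for a path with one blue and one red edge. *)

(* Defs.v *)
From mathcomp Require Import all_boot.
From Stdlib Require Import Relation_Operators.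

Set Implicit Arguments.
Unset Strict Implicit.
Unset Printing Implicit Defensive.

(* The vertex set is a field rather than the whole of T, so that a graph and
   its subgraphs share one type. An edge is the two-element set of its ends. *)
Record graph (T : finType) := Graph {
  vertices : {set T};
  edges : {set {set T}};
  edges_wf : forall e, e \in edges -> (e \subset vertices) && (#|e| == 2)
}.

Definition edge (T : finType) (G : graph T) := {e : {set T} | e \in edges G}.

Definition subgraph (T : finType) (H G : graph T) :=
  (vertices H \subset vertices G) && (edges H \subset edges G).

Definition adj (T : finType) (G : graph T) : rel T :=
  fun x y => [set x; y] \in edges G.

Definition connected (T : finType) (G : graph T) :=
  forall x y, x \in vertices G -> y \in vertices G -> connect (adj G) x y.

(* [next p] is the cyclic successor, so the last vertex of p is joined to the
   first one. *)
Definition is_cycle (T : finType) (C : graph T) :=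
  exists p : seq T,
    [/\ uniq p, 3 <= size p,
        vertices C = [set x in p]
      & edges C = [set [set x; next p x] | x in p]].

Definition is_triangle (T : finType) (K : graph T) :=
  #|vertices K| = 3 /\
  edges K = [set e : {set T} | (e \subset vertices K) && (#|e| == 2)].

Variant color := Blue | Red.

Definition NAC_coloring (T : finType) (G : graph T) (delta : edge G -> color) :=
  (forall c, exists e, delta e = c) /\
  (forall (C : graph T) (c : color), subgraph C G -> is_cycle C ->
     ~ exists! e : edge G, val e \in edges C /\ delta e = c).

Definition triangle_rel (T : finType) (H : graph T) (e1 e2 : edge H) :=
  exists K : graph T,
    [/\ subgraph K H, is_triangle K, val e1 \in edges K & val e2 \in edges K].

(* Vacuously true without edges, and true with a single edge, whatever the
   isolated vertices: [connected] is not implied. *)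
Definition triangle_connected (T : finType) (H : graph T) :=
  forall e1 e2 : edge H, clos_refl_trans (edge H) (@triangle_rel T H) e1 e2.

(* Main.v *)
Require Import Defs.
From mathcomp Require Import all_boot.

(* All edges of a triangle get the same colour, since otherwise one colour would
   occur exactly once on it; hence a triangle-connected H is monochromatic. But
   a connected spanning H meets both colours: an edge of G outside H closes a
   path of H to a cycle, on which its colour has to occur again. *)

Set Implicit Arguments.
Unset Strict Implicit.
Unset Printing Implicit Defensive.

(** [color] has no decidable equality of its own; its injective image in [bool] lets colours be
    compared inside Boolean quantifiers and proofs by contradiction. *)
Definition is_blue (c : color) : bool := if c is Blue then true else false.

Lemma is_blue_inj : injective is_blue.
Proof. by case; case. Qed.

Lemma edge_pair (T : finType) (G : graph T) (e : {set T}) :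
  e \in edges G ->
  exists x y, [/\ x != y, x \in vertices G, y \in vertices G & e = [set x; y]].
Proof.
move=> eG; have /andP[eV /cards2P[x [y [xy eE]]]] := edges_wf eG.
exists x, y; split=> //; apply: (subsetP eV); rewrite eE ?set21 ?set22 //.
Qed.

Lemma triangle_is_cycle (T : finType) (K : graph T) :
  is_triangle K -> is_cycle K.
Proof.
case=> cK eK; exists (enum (vertices K)).
have sp : size (enum (vertices K)) = 3 by rewrite -cardE.
have up := enum_uniq (mem (vertices K)).
have Vp : vertices K = [set x in enum (vertices K)].
  by apply/setP=> x; rewrite inE mem_enum.
split=> //; first by rewrite sp.
rewrite eK {1}Vp; move: (enum (vertices K)) sp up {cK eK Vp} => [|a [|b [|c []]]] // _.
rewrite [uniq _]/= !inE negb_or andbT => /andP[/andP[ab ac] bc].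
have nE : (next [:: a; b; c] a = b) * (next [:: a; b; c] b = c)
        * (next [:: a; b; c] c = a).
  by rewrite /= !eqxx !(eq_sym b a) !(eq_sym c) (negPf ab) (negPf ac) (negPf bc).
apply/setP=> e; apply/idP/imsetP.
  rewrite inE => /andP[/subsetP eV /cards2P[x [y [xy eE]]]].
  have := eV x; have := eV y; rewrite eE set21 set22 !inE => /(_ isT) yV /(_ isT) xV.
  (* Six ordered pairs of distinct vertices remain. Three run along the cyclic order and three
     against it; the latter need [setUC]. *)
  move: yV xV xy; case/or3P=> /eqP->; case/or3P=> /eqP->; rewrite ?eqxx // => _;
  first [ by exists a; rewrite ?nE ?inE ?eqxx ?orbT // setUC
        | by exists b; rewrite ?nE ?inE ?eqxx ?orbT // setUC
        | by exists c; rewrite ?nE ?inE ?eqxx ?orbT // setUC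
        | by exists a; rewrite ?nE ?inE ?eqxx ?orbT
        | by exists b; rewrite ?nE ?inE ?eqxx ?orbT
        | by exists c; rewrite ?nE ?inE ?eqxx ?orbT ].
case=> x; rewrite !inE => /or3P[]/eqP-> ->; rewrite nE cards2 subUset !sub1set;
  by rewrite !inE !eqxx ?orbT ?ab ?bc ?(eq_sym c) ?ac.
Qed.

(** The positive form of the NAC condition: as [edge G] is finite, a second edge of the same colour
    can be searched for, and a failed search would make [e] unique. *)
Lemma NAC_cycle_color_repeated (T : finType) (G C : graph T)
    (delta : edge G -> color) (e : edge G) :
  NAC_coloring delta -> subgraph C G -> is_cycle C -> val e \in edges C ->
  exists f : edge G, [/\ f != e, val f \in edges C & delta f = delta e].
Proof.
move=> [_ nac] CG cC eC.
have [/existsP[f /and3P[fe fC /eqP/is_blue_inj df]]|/existsPn no] :=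
  boolP [exists f : edge G,
    [&& f != e, val f \in edges C & is_blue (delta f) == is_blue (delta e)]].
  by exists f.
case: (nac C (delta e) CG cC); exists e; split=> // f [fC df].
by apply/eqP; have := no f; rewrite fC df eqxx !andbT negbK eq_sym.
Qed.

Lemma NAC_triangle_monochromatic (T : finType) (G K : graph T)
    (delta : edge G -> color) (e1 e2 : edge G) :
  NAC_coloring delta -> subgraph K G -> is_triangle K ->
  val e1 \in edges K -> val e2 \in edges K -> delta e1 = delta e2.
Proof.
move=> nac KG tK e1K e2K; have cK := triangle_is_cycle tK.
apply: is_blue_inj; apply/eqP/idPn => d12.
have [f1 [f1e f1K d1]] := NAC_cycle_color_repeated nac KG cK e1K.
have [f2 [f2e f2K d2]] := NAC_cycle_color_repeated nac KG cK e2K.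
have ne (f g : edge G) : delta f = delta e1 -> delta g = delta e2 -> val f != val g.
  by move=> df dg; apply: contraNneq d12 => /val_inj fg; rewrite -df -dg fg.
(* Two edges of each colour would be four distinct edges, but a triangle has only ['C(3, 2)], which
   is three. *)
have us : uniq [:: val e1; val f1; val e2; val f2].
  rewrite /= !inE !negb_or (ne e1 e2) // (ne e1 f2) // (ne f1 e2) // (ne f1 f2) //.
  by rewrite !(inj_eq val_inj) (eq_sym e1) (eq_sym e2) f1e f2e.
have /(uniq_leq_size us) : {subset [:: val e1; val f1; val e2; val f2] <= enum (edges K)}.
  by move=> s; rewrite mem_enum !inE => /or4P[]/eqP->.
by case: tK => cV eE; rewrite -cardE eE cards_draws cV.
Qed.

Lemma NAC_triangle_connected_monochromatic (T : finType) (G H : graph T)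
    (delta : edge G -> color) (f1 f2 : edge G) :
  NAC_coloring delta -> subgraph H G -> triangle_connected H ->
  val f1 \in edges H -> val f2 \in edges H -> delta f1 = delta f2.
Proof.
move=> nac /andP[HGv HGe] tH f1H f2H.
(* [delta] colours [edge G], while the closure in [triangle_connected] runs over [edge H], so the
   induction is carried out on lifted edges. *)
pose lift (e : edge H) : edge G := exist _ (val e) (subsetP HGe _ (valP e)).
pose restrict (f : edge G) fH : edge H := exist _ (val f) fH.
have liftE f fH : f = lift (@restrict f fH) by apply: val_inj.
rewrite (liftE _ f1H) (liftE _ f2H).
elim: (tH (restrict _ f1H) (restrict _ f2H)) => // [e e' [K [KH tK eK e'K]]|].
  apply: (NAC_triangle_monochromatic nac _ tK) => //.
  by case/andP: KH => KHv KHe; rewrite /subgraph (subset_trans KHv) ?(subset_trans KHe).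
by move=> e e' e'' _ -> _ ->.
Qed.

(** Passes from closed paths in the sense of [cycle] to the subgraphs that [NAC_coloring] speaks
    of. *)
Lemma cycle_subgraph (T : finType) (G : graph T) (p : seq T) :
  cycle (adj G) p -> uniq p -> 3 <= size p ->
  exists C : graph T, [/\ subgraph C G, is_cycle C
    & edges C = [set [set x; next p x] | x in p]].
Proof.
move=> cp up sp; pose E := [set [set x; next p x] | x in p].
have EG e : e \in E -> e \in edges G.
  by case/imsetP=> x xp ->; apply: (next_cycle cp).
have wf e : e \in E -> (e \subset [set x in p]) && (#|e| == 2).
  move=> eE; have /andP[_ ->] := edges_wf (EG e eE); rewrite andbT.
  by case/imsetP: eE => x xp ->; rewrite subUset !sub1set !inE mem_next xp.
exists (Graph wf); split=> //=; last by exists p.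
apply/andP; split; apply/subsetP=> //= x; rewrite inE => xp.
have /edges_wf/andP[/subsetP sV _] := next_cycle cp xp.
by apply: sV; rewrite set21.
Qed.

Lemma next_last (T : eqType) (x : T) (p : seq T) :
  uniq (x :: p) -> next (x :: p) (last x p) = x.
Proof.
(* The index of the last vertex in [x :: p] is [size p], just out of range for [p], so [nth] returns
   its default [x]. *)
by move=> up; rewrite next_nth mem_last (index_last up) nth_default.
Qed.

Lemma NAC_connected_spanning_color (T : finType) (G H : graph T)
    (delta : edge G -> color) (e : edge G) :
  NAC_coloring delta -> subgraph H G -> vertices H = vertices G ->
  connected H -> exists f : edge G, val f \in edges H /\ delta f = delta e.
Proof.
move=> nac /andP[_ HG] VH cH.
have [eH|eH] := boolP (val e \in edges H); first by exists e.
have [x [y [xy xV yV eE]]] := edge_pair (valP e).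
have /connectP[q qH yq] : connect (adj H) x y by apply: cH; rewrite VH.
case/shortenP: qH yq => p pH up _ yp.
(* Besides being edges of [G], the steps of the cycle must be known to lie in [H] or to be [e]; [r]
   keeps this record for the end of the proof. *)
pose r : rel T := fun u v => adj H u v || ([set u; v] == val e).
have rp : cycle r (x :: p).
  rewrite /= rcons_path (sub_path _ pH) /=; last by move=> u v uv; rewrite /r uv.
  by rewrite /r eE yp setUC eqxx orbT.
have cp : cycle (adj G) (x :: p).
  apply: sub_cycle rp => u v /orP[/(subsetP HG)//|/eqP uv].
  by rewrite /adj uv (valP e).
(* An empty [p] would give [x = y], and a single step would put [e] into [H]. *)
have sp : 3 <= size (x :: p).
  move: pH yp eH xy; rewrite eE; case: (p) => [_ ->|z [|//]] /=; first by rewrite eqxx.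
  by rewrite andbT => xz -> /negP.
have [C [CG cC CE]] := cycle_subgraph cp up sp.
have eC : val e \in edges C.
  (* [y] ends the path, so its cyclic successor is [x], and [e] is the closing edge. *)
  rewrite CE eE; apply/imsetP; exists y; first by rewrite yp mem_last.
  by rewrite {3}yp (next_last up) setUC.
have [f [fe fC df]] := NAC_cycle_color_repeated nac CG cC eC.
exists f; split=> //; move: fC; rewrite CE => /imsetP[z zp fz].
(* By [r], the repeated edge [f] lies in [H] unless it is [e], which [fe] excludes. *)
have /orP[|/eqP ze] := next_cycle rp zp; first by rewrite /adj -fz.
by case/eqP: fe; apply: val_inj; rewrite -ze fz.
Qed.

Theorem theorem2 (T : finType) (G : graph T) :
  (exists delta : edge G -> color, NAC_coloring delta) ->
  ~ exists H : graph T,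
      [/\ subgraph H G, vertices H = vertices G, connected H
        & triangle_connected H].
Proof.
move=> [delta nac] [H [HG VH cH tH]].
have colorH c : exists f : edge G, val f \in edges H /\ delta f = c.
  have [e <-] := nac.1 c; exact: (NAC_connected_spanning_color e nac HG VH cH).
have [[b [bH db]] [r [rH dr]]] := (colorH Blue, colorH Red).
have := NAC_triangle_connected_monochromatic nac HG tH bH rH.
by rewrite db dr.
Qed.
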